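(* Let $n\ge 1$ be an integer, let $J=\operatorname{diag}(1,-1,-1,\dots,-1)\in\mathbb{R}^{n\times n}$, and let $L=\{(x_1,\dots,x_n)^\top\in\mathbb{R}^n:\ x_1\ge\sqrt{x_2^2+\dots+x_n^2}\}$ be the Lorentz cone. Let $Z(L)\subseteq\mathbb{R}^{n\times n}$ be the cone of matrices having the Z-property with respect to $L$, and let $Z(L)^*$ be its dual cone in $\mathbb{R}^{n\times n}$ with respect to the trace inner product $\langle A,B\rangle=\operatorname{tr}(A^\top B)$. Then \[ Z(L)^*=\{B\in\mathbb{R}^{n\times n}:\ \operatorname{tr}(B)=0\ \text{ and }\ JB\ \text{ is (symmetric) negative semidefinite}\}. \]
   Context: Linear maps $\mathbb{R}^n\to\mathbb{R}^n$ are identified with their matrices in $\mathbb{R}^{n\times n}$ with respect to the canonical basis. $\mathbb{R}^n$ carries the standard inner product $\langle x,y\rangle=x^\top y$, and $\mathbb{R}^{n\times n}$ carries $\langle A,B\rangle=\operatorname{tr}(A^\top B)$. The dual of a cone $K$ in an inner product space $V$ (here $V=\mathbb{R}^n$ or $V=\mathbb{R}^{n\times n}$) is $K^*=\{z\in V:\ \langle z,v\rangle\ge 0\ \text{for all } v\in K\}$. For a closed convex cone $K\subseteq\mathbb{R}^n$, put $C(K)=\{(x,y)\in\mathbb{R}^n\times\mathbb{R}^n:\ x\in K,\ y\in K^*,\ \langle x,y\rangle=0\}$. A matrix $A\in\mathbb{R}^{n\times n}$ has the Z-property with respect to $K$ if $(x,y)\in C(K)$ implies $\langle Ax,y\rangle\le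 0$. $Z(K)$ denotes the set (a cone) of all $A\in\mathbb{R}^{n\times n}$ having the Z-property with respect to $K$. A matrix $M\in\mathbb{R}^{n\times n}$ is called negative semidefinite if $M$ is symmetric and $x^\top Mx\le 0$ for all $x\in\mathbb{R}^n$, i.e. $-M$ is a symmetric positive semidefinite matrix. *)

(* Defs.v *)
From HB Require Import structures.
From mathcomp Require Import all_boot all_order all_algebra.
From mathcomp Require Import all_classical reals.

Set Implicit Arguments.
Unset Strict Implicit.
Unset Printing Implicit Defensive.

Import Order.TTheory GRing.Theory Num.Theory.

Local Open Scope classical_set_scope.
Local Open Scope ring_scope.

Definition vec_inner (R : realType) (n : nat) (x y : 'cV[R]_n) : R :=
  (x^T *m y) 0 0.

Definition mx_inner (R : realType) (n : nat) (A B : 'M[R]_n) : R :=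
  \tr (A^T *m B).

(* The inner product is a parameter, so that the same definition serves column
   vectors (vec_inner) and square matrices (mx_inner). *)
Definition dual_cone (R : realType) (V : Type) (inner : V -> V -> R)
    (K : set V) : set V :=
  [set z | forall v, K v -> 0 <= inner z v].

Definition compl_set (R : realType) (n : nat) (K : set 'cV[R]_n) :
    set ('cV[R]_n * 'cV[R]_n) :=
  [set p | [/\ K p.1, dual_cone (@vec_inner R n) K p.2
             & vec_inner p.1 p.2 = 0]].

Definition Z_property (R : realType) (n : nat) (K : set 'cV[R]_n)
    (A : 'M[R]_n) : Prop :=
  forall x y : 'cV[R]_n, compl_set K (x, y) -> vec_inner (A *m x) y <= 0.

Definition Z_cone (R : realType) (n : nat) (K : set 'cV[R]_n) : set 'M[R]_n :=
  [set A | Z_property K A].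

Definition neg_semidef (R : realType) (n : nat) (M : 'M[R]_n) : Prop :=
  M^T = M /\ forall x : 'cV[R]_n, (x^T *m M *m x) 0 0 <= 0.

(* The ambient dimension is n.+1, so that every dimension >= 1 is covered; the
   time coordinate has index ord0, the others the indices lift ord0 i. *)
Definition lorentz_J (R : realType) (n : nat) : 'M[R]_n.+1 :=
  diag_mx (\row_(i < n.+1) (if i == ord0 then 1 else -1)).

Definition lorentz_cone (R : realType) (n : nat) : set 'cV[R]_n.+1 :=
  [set x | Num.sqrt (\sum_(i < n) x (lift ord0 i) 0 ^+ 2) <= x ord0 0].

(* Main.v *)
Require Import Defs.
From HB Require Import structures.
From mathcomp Require Import all_boot all_order all_algebra.
From mathcomp Require Import all_classical reals.
From mathcomp Require Import ring lra.

Set Implicit Arguments.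
Unset Strict Implicit.
Unset Printing Implicit Defensive.

Import Order.TTheory GRing.Theory Num.Theory.

Local Open Scope classical_set_scope.
Local Open Scope ring_scope.

(** The theorem holds because Z(L) is cut out by inequalities on the null
    vectors of J.  A complementary pair of the self-dual cone L with both
    members nonzero has the form (p, c J p) with c > 0 and p^T J p = 0, and
    <A p, J p> = p^T J A p; so A lies in Z(L) exactly when the quadratic form of
    J A is nonpositive on the J-null vectors ([Z_cone_lorentzP]).  As J is a
    symmetric involution, <B, A> = tr ((J B)^T (J A)), and the question becomes
    for which B the matrix N = J B satisfies tr (N^T M) >= 0 for every M whose
    form is nonpositive on the J-null vectors.

    Necessity ([dual_Z_lorentz_sub]) comes from testing on a few M.  Both signs
    of M = J are admissible, which gives tr B = 0; both signs of a
    skew-symmetric M are admissible, which makes N symmetric; M = - x x^T is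
    admissible, which gives x^T N x <= 0.

    Sufficiency ([dual_Z_lorentz_sup]) would follow at once if - N were a sum of
    terms v v^T with every v null for J, since then
    tr (N^T M) = - sum v^T M v >= 0.  Elimination writes the positive
    semidefinite matrix - N as such a sum without the nullity
    ([pos_semidef_sum_outer]), and tr B = 0 says that the numbers v^T J v add up
    to zero.  A pair of vectors on which J has opposite signs can be rotated,
    keeping the sum of its outer products, so that one of the two becomes null;
    repeating this makes all of them null ([sum_outer_null]). *)

(** * Bilinear forms of matrices *)

Definition bform (R : realType) (n : nat) (M : 'M[R]_n) (x y : 'cV[R]_n) : R :=
  (x^T *m M *m y) 0 0.

Section BilinearForm.
Variables (R : realType) (n : nat).
Implicit Types (M : 'M[R]_n) (x y z v : 'cV[R]_n).

Lemma bformDl M x y z : bform M (x + y) z = bform M x z + bform M y z.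
Proof. by rewrite /bform linearD /= !mulmxDl mxE. Qed.

Lemma bformDr M x y z : bform M z (x + y) = bform M z x + bform M z y.
Proof. by rewrite /bform mulmxDr mxE. Qed.

Lemma bformZl M a x y : bform M (a *: x) y = a * bform M x y.
Proof. by rewrite /bform linearZ /= -!scalemxAl mxE. Qed.

Lemma bformZr M a x y : bform M x (a *: y) = a * bform M x y.
Proof. by rewrite /bform -scalemxAr mxE. Qed.

Lemma bformN M x y : bform (- M) x y = - bform M x y.
Proof. by rewrite /bform mulmxN mulNmx mxE. Qed.

Lemma bformB M N x y : bform (M - N) x y = bform M x y - bform N x y.
Proof. by rewrite /bform mulmxBr mulmxBl !mxE. Qed.

Lemma bform_tr M x y : bform M^T x y = bform M y x.
Proof.
rewrite /bform; have -> : x^T *m M^T *m y = (y^T *m M *m x)^T.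
  by rewrite !trmx_mul trmxK mulmxA.
by rewrite mxE.
Qed.

Lemma bform_skew M x : M^T = - M -> bform M x x = 0.
Proof. by move=> skM; have := bform_tr M x x; rewrite skM bformN; lra. Qed.

Lemma bform_delta M (i j : 'I_n) :
  bform M (delta_mx i 0) (delta_mx j 0) = M i j.
Proof. by rewrite /bform trmx_delta -rowE -colE !mxE. Qed.

Lemma bform_outer v x y :
  bform (v *m v^T) x y = (x^T *m v) 0 0 * (y^T *m v) 0 0.
Proof.
rewrite /bform mulmxA -mulmxA mxE big_ord1; congr (_ * _).
by rewrite -[in RHS](trmxK v) -trmx_mul [in RHS]mxE.
Qed.

Lemma mxtrace_outer v M : \tr (v *m v^T *m M) = bform M v v.
Proof. by rewrite -mulmxA mxtrace_mulC /mxtrace big_ord1. Qed.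

End BilinearForm.

(** * Positive semidefinite matrices as sums of rank-one terms *)

Definition pos_semidef (R : realType) (n : nat) (M : 'M[R]_n) : Prop :=
  M^T = M /\ forall x : 'cV[R]_n, 0 <= bform M x x.

Definition sum_outer (R : realType) (n : nat) (s : seq 'cV[R]_n) : 'M[R]_n :=
  \sum_(v <- s) v *m v^T.

Section RankOne.
Variables (R : realType) (n : nat).
Implicit Types (M P G : 'M[R]_n) (x y v w : 'cV[R]_n) (s : seq 'cV[R]_n).

Lemma mxtrace_sum_outer s M :
  \tr (sum_outer s *m M) = \sum_(v <- s) bform M v v.
Proof.
rewrite /sum_outer mulmx_suml raddf_sum /=.
by apply: eq_bigr => v _; rewrite mxtrace_outer.
Qed.

Lemma pos_semidef_CauchySchwarz P x y : pos_semidef P ->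
  bform P x y ^+ 2 <= bform P x x * bform P y y.
Proof.
move=> [symP posP].
have symf u v : bform P u v = bform P v u by rewrite -[in LHS]symP bform_tr.
have expand u v t : bform P (u + t *: v) (u + t *: v)
    = bform P u u + t * (bform P u v *+ 2) + t ^+ 2 * bform P v v.
  rewrite bformDl !bformDr !bformZl !bformZr (symf v u); ring.
have [yy0|yyn0] := eqVneq (bform P y y) 0.
  have [-> |xyn0] := eqVneq (bform P x y) 0.
    by rewrite expr0n mulr_ge0.
  (* The form is affine and non-constant along x + t y, hence takes the
     value -1. *)
  have := posP (x + (- (bform P x x + 1) / (bform P x y *+ 2)) *: y).
  rewrite expand yy0 mulr0 addr0 divfK; last by rewrite mulrn_eq0 negb_or.
  by lra.
have yy_gt0 : 0 < bform P y y by rewrite lt_def yyn0 posP.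
have := posP (x + (- bform P x y / bform P y y) *: y).
rewrite expand -(pmulr_rge0 _ yy_gt0) => H.
rewrite -subr_ge0; apply: le_trans H _; rewrite le_eqVlt; apply/orP; left.
by apply/eqP; field.
Qed.

(** One step of symmetric Gaussian elimination: the pivot column, divided by
    the square root of the pivot, gives a rank-one matrix with the same k-th
    row.  A zero pivot forces a zero column, and then [v = 0] works since
    [0^-1 = 0]. *)
Lemma pos_semidef_eliminate P (k : 'I_n) : pos_semidef P ->
  exists v, [/\ pos_semidef (P - v *m v^T),
    row k (P - v *m v^T) = 0
    & forall i, row i P = 0 -> row i (P - v *m v^T) = 0].
Proof.
move=> psdP; have [symP posP] := psdP.
have symE i j : P i j = P j i by rewrite -[in LHS]symP mxE.
have CS x : bform P (delta_mx k 0) x ^+ 2 <= P k k * bform P x x.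
  by rewrite -(bform_delta P k k); apply: pos_semidef_CauchySchwarz.
have a_ge0 : 0 <= P k k by rewrite -bform_delta posP.
pose r := Num.sqrt (P k k).
have r2 : r ^+ 2 = P k k by rewrite sqr_sqrtr.
have kx0 x : r = 0 -> bform P (delta_mx k 0) x = 0.
  move=> r0; apply/eqP; rewrite -sqrf_eq0 eq_le sqr_ge0 andbT.
  by apply: le_trans (CS x) _; rewrite -r2 r0 expr0n mul0r.
pose v := r^-1 *: col k P; exists v.
have defv : v = r^-1 *: col k P by [].
have vE j : v j 0 = r^-1 * P j k by rewrite !mxE.
clearbody v.
have outE i j : (P - v *m v^T) i j = P i j - v i 0 * v j 0.
  by rewrite !mxE big_ord1 mxE.
split.
- split; first by rewrite linearB /= trmx_mul trmxK symP.
  move=> x; rewrite bformB bform_outer -expr2 subr_ge0.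
  have -> : (x^T *m v) 0 0 = r^-1 * bform P (delta_mx k 0) x.
    by rewrite -bform_tr symP /bform -mulmxA -colE defv -scalemxAr mxE.
  have [r0|rn0] := eqVneq r 0.
    by rewrite kx0 // mulr0 expr0n posP.
  have a_gt0 : 0 < P k k by rewrite -r2 exprn_even_gt0.
  by rewrite exprMn exprVn r2 mulrC ler_pdivrMr // mulrC CS.
- apply/rowP => j; rewrite mxE outE mxE !vE.
  have [r0|rn0] := eqVneq r 0.
    by rewrite r0 invr0 !mul0r subr0 -bform_delta kx0.
  by rewrite (symE j k) -r2; field.
- move=> i /rowP Pi0; apply/rowP => j.
  have Pi j' : P i j' = 0 by have := Pi0 j'; rewrite !mxE.
  by rewrite mxE outE mxE !vE !Pi mulr0 mul0r subr0.
Qed.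

(** Elimination at [k] keeps the rows that already vanish, so after a pass over
    all indices the remainder is zero. *)
Lemma pos_semidef_sum_outer P : pos_semidef P -> exists s, P = sum_outer s.
Proof.
move=> psdP.
have [s [_ zeroQ]] : exists s, pos_semidef (P - sum_outer s) /\
    forall i, i \in enum 'I_n -> row i (P - sum_outer s) = 0.
  elim: (enum 'I_n) => [|k ks [s [psdQ zeroQ]]].
    by exists [::]; rewrite /sum_outer big_nil subr0.
  have [v [psdQ' zero_k zeroQ']] := pos_semidef_eliminate k psdQ.
  exists (v :: s); rewrite /sum_outer big_cons -/(sum_outer s).
  rewrite [_ *m _ + _]addrC opprD addrA; split=> // i.
  by rewrite in_cons => /predU1P [-> //|/zeroQ/zeroQ'].
exists s; apply/eqP; rewrite -subr_eq0; apply/eqP/row_matrixP => i.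
by rewrite zeroQ ?mem_enum // row0.
Qed.

(** A Givens rotation of the pair [(v, w)] preserves the sum of the two
    rank-one matrices; when the form takes opposite signs at [v] and [w], it
    vanishes at some [v + t w], and the rotation can be chosen along it. *)
Lemma rotate_to_null G v w : bform G v v * bform G w w < 0 ->
  exists v' w', v' *m v'^T + w' *m w'^T = v *m v^T + w *m w^T
    /\ bform G v' v' = 0.
Proof.
set a := bform G v v; set c := bform G w w => ac_lt0.
pose b := (bform G v w + bform G w v) / 2.
have cn0 : c != 0 by apply: contraTneq ac_lt0 => ->; rewrite mulr0 ltxx.
pose d := Num.sqrt (b ^+ 2 - a * c).
have d2 : d ^+ 2 = b ^+ 2 - a * c.
  by rewrite sqr_sqrtr // subr_ge0; apply: le_trans (ltW ac_lt0) (sqr_ge0 _).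
pose t := (d - b) / c.
have root_t : a + 2 * t * b + t ^+ 2 * c = 0.
  have -> : a + 2 * t * b + t ^+ 2 * c = (d ^+ 2 - (b ^+ 2 - a * c)) / c.
    by rewrite /t; field.
  by rewrite d2 subrr mul0r.
pose r := (Num.sqrt (1 + t ^+ 2))^-1.
have t1_gt0 : 0 < 1 + t ^+ 2 by rewrite ltr_pwDl // sqr_ge0.
have r2 : r * r * (1 + t ^+ 2) = 1.
  by rewrite -expr2 exprVn sqr_sqrtr ?ltW // mulVf // gt_eqF.
exists (r *: (v + t *: w)), (r *: (w - t *: v)); split.
  apply/matrixP => i j; rewrite !mxE !big_ord1 !mxE.
  transitivity (r * r * (1 + t ^+ 2) * (v i 0 * v j 0 + w i 0 * w j 0)).
    by ring.
  by rewrite r2 mul1r.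
rewrite bformZl bformZr bformDl !bformDr !bformZl !bformZr -/a -/c.
have -> : a + t * bform G v w + (t * bform G w v + t * (t * c))
    = a + 2 * t * b + t ^+ 2 * c by rewrite /b; field.
by rewrite root_t !mulr0.
Qed.

(** Supplies the partner for a rotation. *)
Lemma sum_eq0_opposite (T : eqType) (f : T -> R) (s : seq T) (x : T) :
  f x + \sum_(y <- s) f y = 0 -> f x != 0 ->
  exists2 y, y \in s & f x * f y < 0.
Proof.
move=> sum0 fx0; apply/hasP; apply: contraT => /hasPn nolt.
have : 0 < f x * (f x + \sum_(y <- s) f y).
  rewrite mulrDr ltr_pwDl ?exprn_even_gt0 // -?expr2 ?exprn_even_gt0 //.
  rewrite mulr_sumr big_seq; apply: sumr_ge0 => y ys.
  by rewrite leNgt nolt.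
by rewrite sum0 mulr0 ltxx.
Qed.

(** The rank-one decomposition of Sturm and Zhang: each rotation splits off one
    null vector and leaves a shorter list with the same total. *)
Lemma sum_outer_null G s : \sum_(v <- s) bform G v v = 0 ->
  exists2 s', sum_outer s' = sum_outer s
    & forall v, v \in s' -> bform G v v = 0.
Proof.
have [m] := ubnP (size s); elim: m s => // m IH [|v s] /= size_s sum0.
  by exists [::].
have cons_null v' s1 : bform G v' v' = 0 -> (size s1 < m)%N ->
    v' *m v'^T + sum_outer s1 = sum_outer (v :: s) ->
  exists2 s', sum_outer s' = sum_outer (v :: s)
    & forall u, u \in s' -> bform G u u = 0.
  move=> v'0 size1 eq1.
  have sum1 : \sum_(u <- s1) bform G u u = 0.
    rewrite -[RHS]sum0 -!mxtrace_sum_outer -eq1.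
    by rewrite mulmxDl mxtraceD mxtrace_outer v'0 add0r.
  have [s2 eq2 null2] := IH s1 size1 sum1.
  exists (v' :: s2); first by rewrite /sum_outer big_cons -/(sum_outer s2) eq2.
  by move=> u; rewrite in_cons => /predU1P [-> //|/null2].
have [v0|vn0] := eqVneq (bform G v v) 0.
  by apply: (cons_null v s) => //; rewrite /sum_outer big_cons.
rewrite big_cons in sum0.
have [w ws vw_lt0] := sum_eq0_opposite (f := fun u => bform G u u) sum0 vn0.
have [v' [w' [rot v'0]]] := rotate_to_null vw_lt0.
apply: (cons_null v' (w' :: rem w s)) => //.
  by rewrite /= size_rem // prednK //; case: (s) ws.
rewrite /sum_outer !big_cons [in RHS](perm_big _ (perm_to_rem ws)) big_cons /=.
by rewrite !addrA rot.
Qed.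

End RankOne.

(** * The Lorentz cone *)

Section Lorentz.
Variables (R : realType) (n : nat).
Notation J := (lorentz_J R n).
Notation L := (@lorentz_cone R n).
Implicit Types (A B : 'M[R]_n.+1) (x y : 'cV[R]_n.+1).

Lemma lorentz_J_tr : J^T = J.
Proof. exact: tr_diag_mx. Qed.

Lemma lorentz_JE x i : (J *m x) i 0 = if i == ord0 then x i 0 else - x i 0.
Proof.
by rewrite mul_diag_mx !mxE; case: eqP => _; rewrite ?mul1r ?mulN1r.
Qed.

Lemma lorentz_JK m (M : 'M[R]_(n.+1, m)) : J *m (J *m M) = M.
Proof.
rewrite mulmxA mulmx_diag; apply/matrixP => i j.
by rewrite mul_diag_mx !mxE; case: eqP => _; rewrite ?mulrNN !mul1r.
Qed.

Lemma vec_innerE x y :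
  vec_inner x y = x ord0 0 * y ord0 0
                  + \sum_(i < n) x (lift ord0 i) 0 * y (lift ord0 i) 0.
Proof.
rewrite /vec_inner mxE big_ord_recl mxE; congr (_ + _).
by apply: eq_bigr => i _; rewrite mxE.
Qed.

Lemma vec_inner_J A x : vec_inner (A *m x) (J *m x) = bform (J *m A) x x.
Proof.
by rewrite -bform_tr /vec_inner /bform !trmx_mul lorentz_J_tr !mulmxA.
Qed.

Lemma bform_J x :
  bform J x x = x ord0 0 ^+ 2 - \sum_(i < n) x (lift ord0 i) 0 ^+ 2.
Proof.
rewrite -[J]mulmx1 -vec_inner_J mul1mx vec_innerE lorentz_JE eqxx -expr2.
rewrite -sumrN; congr (_ + _); apply: eq_bigr => i _.
by rewrite lorentz_JE /= mulrN expr2.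
Qed.

Lemma lorentz_coneP x :
  L x <-> 0 <= x ord0 0 /\ \sum_(i < n) x (lift ord0 i) 0 ^+ 2 <= x ord0 0 ^+ 2.
Proof.
have S_ge0 : 0 <= \sum_(i < n) x (lift ord0 i) 0 ^+ 2.
  by apply: sumr_ge0 => i _; apply: sqr_ge0.
rewrite /lorentz_cone /=; split => [le_x|[x_ge0 le_x]].
  have x_ge0 : 0 <= x ord0 0 := le_trans (sqrtr_ge0 _) le_x.
  by split=> //; rewrite -(sqr_sqrtr S_ge0) ler_sqr ?nnegrE ?sqrtr_ge0.
by rewrite -[leRHS]ger0_norm // -sqrtr_sqr ler_wsqrtr.
Qed.

Lemma sum_sqr_lin (a b : R) (u w : 'I_n -> R) :
  \sum_(i < n) (a * u i + b * w i) ^+ 2 =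
  a ^+ 2 * (\sum_(i < n) u i ^+ 2) + 2 * a * b * (\sum_(i < n) u i * w i)
  + b ^+ 2 * (\sum_(i < n) w i ^+ 2).
Proof.
by rewrite !mulr_sumr -!big_split /=; apply: eq_bigr => i _; ring.
Qed.

Lemma lorentz_cone0 x : L x -> x ord0 0 = 0 -> x = 0.
Proof.
move=> /lorentz_coneP [_]; move=> + x0; rewrite x0 expr0n /= => S_le0.
have /psumr_eq0P sq0 : \sum_(i < n) x (lift ord0 i) 0 ^+ 2 = 0.
  by apply/le_anti; rewrite S_le0 /=; apply: sumr_ge0 => i _; apply: sqr_ge0.
apply/colP => i; rewrite mxE; case: (unliftP ord0 i) => [j ->|-> //].
by apply/eqP; rewrite -sqrf_eq0; apply/eqP/sq0 => // k _; apply: sqr_ge0.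
Qed.

Lemma lorentz_cone_inner_ge0 x y : L x -> L y -> 0 <= vec_inner x y.
Proof.
move=> Lx Ly.
have [x0|xn0] := eqVneq (x ord0 0) 0.
  by rewrite (lorentz_cone0 Lx x0) /vec_inner trmx0 mul0mx mxE.
have [y0|yn0] := eqVneq (y ord0 0) 0.
  by rewrite (lorentz_cone0 Ly y0) /vec_inner mulmx0 mxE.
have [x_ge0 Sx] := (lorentz_coneP x).1 Lx.
have [y_ge0 Sy] := (lorentz_coneP y).1 Ly.
rewrite vec_innerE; set s := \sum_(i < n) _ * _.
have x_gt0 : 0 < x ord0 0 by rewrite lt_def xn0.
have y_gt0 : 0 < y ord0 0 by rewrite lt_def yn0.
have xy_gt0 : 0 < x ord0 0 * y ord0 0 by rewrite mulr_gt0.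
have : 0 <= \sum_(i < n) (y ord0 0 * x (lift ord0 i) 0
                          + x ord0 0 * y (lift ord0 i) 0) ^+ 2.
  by apply: sumr_ge0 => i _; apply: sqr_ge0.
rewrite sum_sqr_lin -/s => H.
rewrite -(pmulr_rge0 _ xy_gt0).
have H1 := ler_wpM2l (sqr_ge0 (y ord0 0)) Sx.
have H2 := ler_wpM2l (sqr_ge0 (x ord0 0)) Sy.
by lra.
Qed.

(** The other half of self-duality.  The vector of [L] on which [y] is tested is
    the reflected ray [(|w|, - w)], with [w] the space part of [y]. *)
Lemma dual_lorentz_cone y : dual_cone (@vec_inner R n.+1) L y -> L y.
Proof.
move=> dualy.
pose S := \sum_(i < n) y (lift ord0 i) 0 ^+ 2.
have S_ge0 : 0 <= S by apply: sumr_ge0 => i _; apply: sqr_ge0.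
pose v (t a : R) : 'cV[R]_n.+1 :=
  \col_i (if i == ord0 then t else - a * y i 0).
have v_inner t a : vec_inner y (v t a) = y ord0 0 * t - a * S.
  rewrite vec_innerE mxE eqxx /S mulr_sumr -sumrN; congr (_ + _).
  by apply: eq_bigr => i _; rewrite mxE /=; ring.
have vL t a : 0 <= t -> a ^+ 2 * S <= t ^+ 2 -> L (v t a).
  move=> t_ge0 le_t; apply/lorentz_coneP; rewrite mxE eqxx; split=> //.
  apply: le_trans le_t; rewrite mulr_sumr le_eqVlt; apply/orP; left.
  by apply/eqP; apply: eq_bigr => i _; rewrite mxE /=; ring.
have y_ge0 : 0 <= y ord0 0.
  have := dualy _ (vL 1 0 ler01 _).
  rewrite v_inner expr0n expr1n /= !mul0r ler01 => /(_ isT).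
  by rewrite subr0 mulr1.
rewrite /lorentz_cone /= -/S.
have sqS : Num.sqrt S ^+ 2 = S by rewrite sqr_sqrtr.
have [-> //|sn0] := eqVneq (Num.sqrt S) 0.
have s_gt0 : 0 < Num.sqrt S by rewrite lt_def sn0 sqrtr_ge0.
have := dualy _ (vL (Num.sqrt S) 1 (sqrtr_ge0 _) _).
rewrite v_inner expr1n !mul1r sqS lexx => /(_ isT).
by rewrite subr_ge0 -[leLHS]sqS expr2 ler_pM2r.
Qed.

(** Equality in Cauchy-Schwarz: orthogonality of [x = (t, u)] and [y = (s, w)]
    in [L] forces [s u + t w = 0], so [y = (s / t) J x] unless [t = 0]. *)
Lemma compl_lorentz_cone x y : compl_set L (x, y) ->
  x = 0 \/ exists2 c, 0 <= c & y = c *: (J *m x).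
Proof.
move=> [/= Lx /dual_lorentz_cone Ly xy0].
have [x0|xn0] := eqVneq (x ord0 0) 0; first by left; apply: lorentz_cone0.
right; have [x_ge0 Sx] := (lorentz_coneP x).1 Lx.
have [y_ge0 Sy] := (lorentz_coneP y).1 Ly.
exists (y ord0 0 / x ord0 0); first by rewrite divr_ge0.
(* The sum is at most s^2 t^2 + 2 s t (- s t) + t^2 s^2 = 0. *)
have sum0 : \sum_(i < n) (y ord0 0 * x (lift ord0 i) 0
                          + x ord0 0 * y (lift ord0 i) 0) ^+ 2 = 0.
  apply/le_anti/andP; split; last by apply: sumr_ge0 => i _; apply: sqr_ge0.
  rewrite sum_sqr_lin.
  have H1 := ler_wpM2l (sqr_ge0 (y ord0 0)) Sx.
  have H2 := ler_wpM2l (sqr_ge0 (x ord0 0)) Sy.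
  move: xy0; rewrite vec_innerE => /eqP; rewrite addrC addr_eq0 => /eqP ->.
  by lra.
apply/colP => i; rewrite mxE lorentz_JE.
case: (unliftP ord0 i) => [j ->|->]; last by rewrite eqxx divfK.
have /eqP : (y ord0 0 * x (lift ord0 j) 0
             + x ord0 0 * y (lift ord0 j) 0) ^+ 2 = 0.
  by apply: (psumr_eq0P _ sum0) => // k _; apply: sqr_ge0.
rewrite sqrf_eq0 addrC addr_eq0 /= => /eqP xy.
by apply: (mulfI xn0); rewrite xy; field.
Qed.

(** For a [J]-null [p] in [L], the pair [(p, J p)] is complementary, and
    [compl_lorentz_cone] says that up to scaling only trivial pairs are missed.
    Null vectors with a negative time coordinate are covered because quadratic
    forms are even. *)
Lemma Z_cone_lorentzP A :
  Z_cone L A <-> forall p, bform J p p = 0 -> bform (J *m A) p p <= 0.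
Proof.
split=> [ZA p null_p|nullA x y].
  wlog p_ge0 : p null_p / 0 <= p ord0 0 => [hwlog|].
    have [/hwlog->//|p_lt0] := leP 0 (p ord0 0).
    have opp M : bform M (-1 *: p) (-1 *: p) = bform M p p.
      by rewrite bformZl bformZr !mulN1r opprK.
    by rewrite -opp; apply: hwlog; rewrite ?opp // mxE mulN1r oppr_ge0 ltW.
  have := null_p; rewrite bform_J => /eqP; rewrite subr_eq0 => /eqP null_p'.
  rewrite -vec_inner_J; apply: ZA; split=> /=.
  - by apply/lorentz_coneP; rewrite null_p'.
  - move=> v; apply: lorentz_cone_inner_ge0; apply/lorentz_coneP.
    rewrite lorentz_JE eqxx null_p'; split=> //; rewrite le_eqVlt.
    apply/orP; left; apply/eqP; apply: eq_bigr => i _.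
    by rewrite lorentz_JE /= sqrrN.
  - by have := vec_inner_J 1%:M p; rewrite mul1mx mulmx1 => ->.
move=> Cxy; have [_ _ /= xy0] := Cxy.
have [->|[c c_ge0 yE]] := compl_lorentz_cone Cxy.
  by rewrite /vec_inner mulmx0 trmx0 mul0mx mxE.
have scale M : vec_inner (M *m x) y = c * bform (J *m M) x x.
  by rewrite -vec_inner_J yE /vec_inner -scalemxAr mxE.
have := scale 1%:M; rewrite mul1mx xy0 mulmx1 scale => /esym/eqP.
rewrite mulf_eq0 => /orP [/eqP ->|/eqP null_x]; first by rewrite mul0r.
by rewrite mulr_ge0_le0 // nullA.
Qed.

Lemma mx_inner_J B M : mx_inner B (J *m M) = \tr ((J *m B)^T *m M).
Proof. by rewrite /mx_inner trmx_mul lorentz_J_tr mulmxA. Qed.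

Lemma dual_Z_lorentz_sub B : dual_cone (@mx_inner R n.+1) (Z_cone L) B ->
  \tr B = 0 /\ neg_semidef (J *m B).
Proof.
move=> dualB; set N := J *m B.
(* Substituting A = J M absorbs the factor J on both sides of the pairing. *)
have test M : (forall p, bform J p p = 0 -> bform M p p <= 0) ->
    0 <= \tr (N^T *m M).
  move=> nullM; rewrite -mx_inner_J; apply/dualB/Z_cone_lorentzP => p.
  by rewrite lorentz_JK; apply: nullM.
have test_pm M : (forall p, bform J p p = 0 -> bform M p p = 0) ->
    \tr (N^T *m M) = 0.
  move=> nullM; apply/le_anti/andP; split.
    rewrite -oppr_ge0 -raddfN -mulmxN; apply: test => p /nullM.
    by rewrite bformN => ->; rewrite oppr0.
  by apply: test => p /nullM ->.
split; [|split].
- rewrite -mxtrace_tr -[B](lorentz_JK) -/N trmx_mul lorentz_J_tr.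
  exact: test_pm.
- apply/matrixP => i j; rewrite mxE; apply/eqP; rewrite -subr_eq0; apply/eqP.
  have trE k l : \tr (N^T *m delta_mx k l) = N k l.
    have -> : delta_mx k l
        = delta_mx k 0 *m (delta_mx l (0 : 'I_1))^T :> 'M[R]_n.+1.
      by rewrite trmx_delta mul_delta_mx.
    rewrite mulmxA mxtrace_mulC mulmxA.
    by rewrite /mxtrace big_ord1 -/(bform _ _ _) bform_tr bform_delta.
  (* Pairing with the skew matrix E_ij - E_ji reads off N i j - N j i. *)
  rewrite -!trE -raddfB -mulmxBr; apply: test_pm => p _.
  by apply: bform_skew; rewrite linearB /= !trmx_delta opprB.
- move=> x; rewrite -/(bform N x x) -bform_tr -mxtrace_outer mxtrace_mulC.
  (* The test matrix is - x x^T. *)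
  rewrite -oppr_ge0 -raddfN -mulmxN; apply: test => p _.
  by rewrite bformN bform_outer oppr_le0 -expr2 sqr_ge0.
Qed.

Lemma dual_Z_lorentz_sup B : \tr B = 0 -> neg_semidef (J *m B) ->
  dual_cone (@mx_inner R n.+1) (Z_cone L) B.
Proof.
move=> trB0 [symN negN] A /Z_cone_lorentzP ZA.
have psd : pos_semidef (- (J *m B)).
  split=> [|x]; first by rewrite linearN /= symN.
  by rewrite bformN oppr_ge0 negN.
have [s0 Ns0] := pos_semidef_sum_outer psd.
have [s s_s0 nullv] : exists2 s, sum_outer s = sum_outer s0
    & forall v, v \in s -> bform J v v = 0.
  apply: sum_outer_null; rewrite -mxtrace_sum_outer -Ns0 mulNmx raddfN /=.
  by rewrite mxtrace_mulC lorentz_JK trB0 oppr0.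
rewrite -[A]lorentz_JK mx_inner_J symN -[J *m B]opprK Ns0 -s_s0 mulNmx.
rewrite raddfN /= mxtrace_sum_outer oppr_ge0 big_seq; apply: sumr_le0 => v /nullv.
exact: ZA.
Qed.

End Lorentz.

Theorem theorem1 (R : realType) (n : nat) :
  dual_cone (@mx_inner R n.+1) (Z_cone (@lorentz_cone R n)) =
  [set B : 'M[R]_n.+1 | \tr B = 0 /\ neg_semidef (lorentz_J R n *m B)].
Proof.
apply/seteqP; split=> [B|B [trB0 negB]]; first exact: dual_Z_lorentz_sub.
exact: dual_Z_lorentz_sup.
Qed.
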